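(* Let $S$ be a semigroup and $\sigma:S\to S$ an involutive automorphism. The solutions $f,g,h:S\to\mathbb{C}$ of the functional equation $$f(x\sigma(y))=f(x)g(y)+g(x)f(y)+h(x)h(y),\qquad x,y\in S,$$ such that $h^{e}$ and $f^{e}$ are linearly dependent and $f^{e}(S^{2})=\{0\}$ are exactly the following triples of functions $f,g,h:S\to\mathbb{C}$: (A) $f=0$, $g$ arbitrary and $h=0$. (B) $f$ is any non-zero function such that $f(S^{2})=\{0\}$, $g=-\frac{\lambda^{2}}{2}f$ and $h=\lambda f$, where $\lambda\in\mathbb{C}$ is a constant.
   Context: $S$ is a semigroup (a set with an associative composition), and $\sigma:S\to S$ is an automorphism with $\sigma(\sigma(x))=x$ for all $x\in S$. $S^{2}:=\{xy\mid x,y\in S\}$. For $F:S\to\mathbb{C}$, $F^{*}:=F\circ\sigma$ and $F^{e}:=\frac{F+F^{*}}{2}$ is the even part of $F$. *)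

(* Defs.v *)
From mathcomp Require Import all_boot all_order all_algebra.
From mathcomp Require Import boolp classical_sets functions reals.
From mathcomp Require Import complex.

Set Implicit Arguments.
Unset Strict Implicit.
Unset Printing Implicit Defensive.

Import GRing.Theory Num.Theory.

Local Open Scope classical_set_scope.
Local Open Scope ring_scope.
Local Open Scope complex_scope.

Definition products (S : magmaType) : set S :=
  [set (x * y)%g | x in [set: S] & y in [set: S]].
Arguments products : clear implicits.

(* For nonempty S this is F(S^2) = {0}, see vanishes_on_productsE; the
   inclusion also makes sense for the empty semigroup, where S^2 is empty. *)
Definition vanishes_on_products (R : realType) (S : magmaType)
    (F : S -> R[i]) : Prop :=
  F @` products S `<=` [set 0].

Lemma vanishes_on_productsE (R : realType) (S : magmaType) (s : S)
    (F : S -> R[i]) :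
  vanishes_on_products F <-> F @` products S = [set 0].
Proof.
split=> [F0|]; last by rewrite /vanishes_on_products => ->.
apply/seteqP; split=> // _ ->.
have ss : products S (s * s)%g by exists s => //; exists s.
by exists (s * s)%g => //; apply: F0; exists (s * s)%g.
Qed.

Definition even_part (R : realType) (S : Type) (sigma : S -> S)
    (F : S -> R[i]) : S -> R[i] :=
  fun x => (F x + F (sigma x)) / 2.

Definition lin_dependent (K : fieldType) (V : lmodType K) (u v : V) : Prop :=
  exists a b : K, (a, b) != (0, 0) /\ a *: u + b *: v = 0.

(* Main.v *)
Require Import Defs.
From mathcomp Require Import all_boot all_order all_algebra.
From mathcomp Require Import boolp classical_sets functions reals.
From mathcomp Require Import complex.
From mathcomp Require Import ring.

Import GRing.Theory Num.Theory.
Local Open Scope ring_scope.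
Local Open Scope complex_scope.

(** The right-hand side of the equation is B(u x, u y), where u = (f, g, h)
    and B is the symmetric bilinear form whose quadratic form is
    2 f g + h ^+ 2. Suppose that some p satisfies f p != 0 and
    f (x * sigma p) = 0 for all x. Then all values of u are orthogonal to the
    isotropic vector u p, and on the orthogonal complement of an isotropic
    vector, B is proportional to the square of one linear form: with
    D x := f x * h p - h x * f p,
      f p ^+ 2 * f (x * sigma y) = D x * D y   (isotropic_square).
    As f is odd on products, applying sigma to both x and y changes the sign
    of D x * D y, which forces D = 0 (twisted_square0). Hence f vanishes on
    products and h is a multiple of f; the value of g is then read off the
    equation (solution_of_isotropic_point).

    It remains to find p when f != 0. If f vanishes on products, any p with
    f p != 0 works. Otherwise p is a product with f p != 0: the symmetry of
    the equation together with oddness makes f anticommutative on products,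
    and an anticommutative function vanishes on triple products
    (anticommutative_mul3). *)

(** The bilinear form f1 g2 + g1 f2 + h1 h2 is nondegenerate on a
    three-dimensional space. So a nonzero isotropic vector (a, b, c) lies in
    its own two-dimensional orthogonal complement, where it spans a radical:
    the form has rank at most one there. Each factor on the right-hand side is
    a linear form that vanishes at (a, b, c). *)
Lemma isotropic_square {K : comNzRingType} (a b c f1 g1 h1 f2 g2 h2 : K) :
    a * b + b * a + c * c = 0 ->
    f1 * b + g1 * a + h1 * c = 0 -> f2 * b + g2 * a + h2 * c = 0 ->
  a ^+ 2 * (f1 * g2 + g1 * f2 + h1 * h2)
    = (f1 * c - h1 * a) * (f2 * c - h2 * a).
Proof.
move=> E0 E1 E2; apply/eqP; rewrite -subr_eq0; apply/eqP.
transitivity (a * f1 * (f2 * b + g2 * a + h2 * c)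
  + a * f2 * (f1 * b + g1 * a + h1 * c)
  - f1 * f2 * (a * b + b * a + c * c)); first by ring.
by rewrite E0 E1 E2 !mulr0 subr0 addr0.
Qed.

(** Taking y = sigma x gives 2 D x * D (sigma x) = 0, so D vanishes at x or at
    sigma x; taking y = x, it vanishes at both. *)
Lemma twisted_square0 {K : numDomainType} {S : Type} {sigma : S -> S}
    {D : S -> K} :
    involutive sigma ->
    (forall x y, D (sigma x) * D (sigma y) = - (D x * D y)) ->
  forall x, D x = 0.
Proof.
move=> sigmaK DN x.
have /eqP : D x * D (sigma x) = 0.
  have := DN x (sigma x); rewrite sigmaK mulrC => /eqP.
  by rewrite -addr_eq0 -mulr2n mulrn_eq0 /= => /eqP.
rewrite mulf_eq0 => /orP[/eqP //|/eqP Ds0].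
have /eqP := DN x x; rewrite Ds0 mulr0 eq_sym oppr_eq0.
by rewrite mulf_eq0 orbb => /eqP.
Qed.

(** Each cyclic rotation of x * y * z through the anticommutation rule changes
    the sign, and three of them restore the word. *)
Lemma anticommutative_mul3 {K : numDomainType} {S : semigroupType}
    {f : S -> K} :
    (forall x y, f (x * y)%g = - f (y * x)%g) ->
  forall x y z, f (x * (y * z))%g = 0.
Proof.
move=> fC x y z.
have fR a b c : f (a * (b * c))%g = - f (b * (c * a))%g by rewrite fC mulgA.
have /eqP := fR x y z.
rewrite (fR y) (fR z) opprK -addr_eq0 -mulr2n mulrn_eq0.
by move/eqP.
Qed.

Lemma vanishes_on_productsP {R : realType} {S : magmaType} (F : S -> R[i]) :
  vanishes_on_products F <-> forall x y, F (x * y)%g = 0.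
Proof.
split=> [F0 x y|F0 _ [_ [x _ [y _ <-]] <-]]; last exact: F0.
by apply: F0; exists (x * y)%g => //; exists x => //; exists y.
Qed.

Lemma even_part0 {R : realType} {S : Type} (sigma : S -> S) (F : S -> R[i])
    (x : S) : even_part sigma F x = 0 -> F (sigma x) = - F x.
Proof.
move=> /eqP; rewrite mulf_eq0 invr_eq0 pnatr_eq0 orbF addrC addr_eq0.
by move/eqP.
Qed.

Section Equation.

Context {K : numFieldType} {S : semigroupType}.
Context {sigma : {multiplicative S -> S}} {f g h : S -> K}.
Hypothesis sigmaK : involutive sigma.
Hypothesis fE : forall x y,
  f (x * sigma y)%g = f x * g y + g x * f y + h x * h y.
Hypothesis f_odd : forall x y, f (sigma (x * y)%g) = - f (x * y)%g.

(** The right-hand side of the equation is symmetric, which gives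
    f (x * y) = f (sigma y * sigma x); oddness removes sigma. *)
Lemma solution_anticommutative x y : f (x * y)%g = - f (y * x)%g.
Proof.
rewrite -f_odd gmulfM fE -{1}(sigmaK y) fE; ring.
Qed.

(** By the equation, the hypothesis on p says that (f x, g x, h x) is orthogonal
    to (f p, g p, h p) for all x; for x = p, the latter vector is isotropic. *)
Lemma solution_of_isotropic_point {p : S} :
    f p != 0 -> (forall x, f (x * sigma p)%g = 0) ->
  [/\ forall x y, f (x * y)%g = 0,
      forall x, h x = h p / f p * f x
    & forall x, g x = - ((h p / f p) ^+ 2 / 2) * f x].
Proof.
move=> fp0 fp; pose D x := f x * h p - h x * f p.
have fD x y : f p ^+ 2 * f (x * sigma y)%g = D x * D y.
  by rewrite fE; apply: (@isotropic_square _ (f p) (g p)); rewrite -fE fp.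
have D0 : forall x, D x = 0.
  apply: (twisted_square0 sigmaK) => x y.
  by rewrite -!fD -gmulfM f_odd mulrN.
have hE x : h x = h p / f p * f x.
  by apply: (mulIf fp0); rewrite -(subr0_eq (D0 x)); field.
split=> // [x y|x].
  apply: (mulfI (expf_neq0 2 fp0)).
  by rewrite -{1}(sigmaK y) fD D0 mul0r mulr0.
have Ep : f p * g p + g p * f p + h p * h p = 0 by rewrite -fE.
have Ex : f x * g p + g x * f p + h x * h p = 0 by rewrite -fE.
(* Ep determines g p, and then Ex, in which h x is known, determines g x. *)
apply: (mulIf (expf_neq0 2 fp0)); apply: subr0_eq.
transitivity (f p * (f x * g p + g x * f p + h x * h p)
  - f x / 2 * (f p * g p + g p * f p + h p * h p)).
  by rewrite (hE x); field.
by rewrite Ex Ep !mulr0 subr0.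
Qed.

Lemma exists_isotropic_point :
  f <> 0 -> exists2 p, f p != 0 & forall x, f (x * sigma p)%g = 0.
Proof.
move=> f0; have [fM|] := pselect (forall x y, f (x * y)%g = 0).
  have /existsNP[p /eqP fp] : ~ forall p, f p = 0.
    by move=> f0'; apply: f0; apply/funext.
  by exists p.
move=> /existsNP[u /existsNP[v /eqP fuv]]; exists (u * v)%g => // x.
rewrite gmulfM; exact: (anticommutative_mul3 solution_anticommutative).
Qed.

End Equation.

(* Bijectivity of sigma follows from involutive sigma (inv_bij). *)
Theorem theorem4p1 (R : realType) (S : semigroupType)
    (sigma : {multiplicative S -> S}) (sigmaK : involutive sigma)
    (f g h : S -> R[i]) :
  [/\ forall x y : S,
        f (x * sigma y)%g = f x * g y + g x * f y + h x * h y,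
      lin_dependent (even_part sigma h) (even_part sigma f)
    & vanishes_on_products (even_part sigma f)]
  <->
  (f = 0 /\ h = 0) \/
  (exists lambda : R[i],
     [/\ f <> 0, vanishes_on_products f,
         g = - (lambda ^+ 2 / 2) *: f & h = lambda *: f]).
Proof.
split=> [[fE _ /vanishes_on_productsP fe0]|].
  have f_odd x y : f (sigma (x * y)%g) = - f (x * y)%g.
    exact/even_part0/fe0.
  have [f0|f0] := pselect (f = 0); [left|right].
    split=> //; apply/funext => x; apply/eqP.
    by have /esym/eqP := fE x x; rewrite f0 mul0r mulr0 !add0r mulf_eq0 orbb.
  have [p fp0 fp] := exists_isotropic_point sigmaK fE f_odd f0.
  have [fM hE gE] := solution_of_isotropic_point sigmaK fE f_odd fp0 fp.
  exists (h p / f p); split=> //; first exact/vanishes_on_productsP.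
    exact/funext/gE.
  exact/funext/hE.
case=> [[-> ->]|[lambda [_ /vanishes_on_productsP fM -> ->]]].
  have even0 : even_part sigma (0 : S -> R[i]) = 0.
    by apply/funext => x; rewrite /even_part addr0 mul0r.
  split=> [x y||]; first by rewrite !mul0r mulr0 !addr0.
    exists 1, 1; rewrite even0 !scaler0 addr0; split=> //.
    by rewrite xpair_eqE oner_eq0.
  by rewrite even0; apply/vanishes_on_productsP.
split=> [x y||].
- have scaleE (a : R[i]) z : (a *: f) z = a * f z by [].
  by rewrite fM !scaleE; field.
- exists 1, (- lambda); split; first by rewrite xpair_eqE oner_eq0.
  apply/funext => x; rewrite /even_part.
  change (1 * ((lambda * f x + lambda * f (sigma x)) / 2)
    + - lambda * ((f x + f (sigma x)) / 2) = 0); ring.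
- apply/vanishes_on_productsP => x y.
  by rewrite /even_part gmulfM !fM addr0 mul0r.
Qed.
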